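(* Let $r$ be an integer and let $G$ be a $(P_6+rP_3)$-free graph. Let $v\in V(G)$ be such that $G|N(v)$ is connected and bipartite, with (unique) bipartition $(A_1,A_2)$, and let $G'$ be obtained from $G$ by reducing $v$. Then $G'$ is $(P_6+rP_3)$-free.
   Context: Graphs are finite and simple; $P_6+rP_3$ is the disjoint union of a 6-vertex path and $r$ copies of the 3-vertex path; $H$-free means no induced subgraph isomorphic to $H$; $N(v)$ is the set of neighbors of $v$ and $G|A$ the induced subgraph on $A$. For $v$ with $G|N(v)$ connected and bipartite with bipartition $(A_1,A_2)$, the graph $G'$ obtained from $G$ by reducing $v$ has vertex set $(V(G)\setminus(\{v\}\cup N(v)))\cup\{a_1,a_2\}$ for two new vertices $a_1,a_2$, where $G'$ minus $\{a_1,a_2\}$ equals $G$ minus $(\{v\}\cup N(v))$, $a_1a_2\in E(G')$, and for $u\in V(G)\cap V(G')$ and $i\in\{1,2\}$, $a_iu\in E(G')$ if and only if $u$ has a neighbor in $A_i$ in $G$. *)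

(* Defs.v *)
From mathcomp Require Import all_boot.

Set Implicit Arguments.
Unset Strict Implicit.
Unset Printing Implicit Defensive.

Record sgraph := SGraph {
  vertex :> finType;
  edge : rel vertex;
  edge_sym : symmetric edge;
  edge_irrefl : irreflexive edge }.

Definition isomorphic (G H : sgraph) : Prop :=
  exists f : G -> H, bijective f /\ {mono f : x y / edge x y}.

Section Induced.
Variables (G : sgraph) (A : {set G}).

Definition induced_edge : rel {x : G | x \in A} :=
  [rel x y | edge (val x) (val y)].

Lemma induced_edge_sym : symmetric induced_edge.
Proof. by move=> x y; apply: edge_sym. Qed.

Lemma induced_edge_irrefl : irreflexive induced_edge.
Proof. by move=> x; apply: edge_irrefl. Qed.

Definition induced := SGraph induced_edge_sym induced_edge_irrefl.
End Induced.

Definition free (H G : sgraph) : Prop :=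
  forall A : {set G}, ~ isomorphic (induced A) H.

Section PathGraph.
Variable n : nat.

Definition path_edge : rel 'I_n :=
  [rel i j : 'I_n | (i.+1 == j :> nat) || (j.+1 == i :> nat)].

Lemma path_edge_sym : symmetric path_edge.
Proof. by move=> i j; rewrite /path_edge /= orbC. Qed.

Lemma path_edge_irrefl : irreflexive path_edge.
Proof. by move=> i; rewrite /path_edge /= orbb eqn_leq ltnn. Qed.

(* n is the number of vertices, not of edges. *)
Definition path_graph := SGraph path_edge_sym path_edge_irrefl.
End PathGraph.

Section DisjointUnion.
Variables G H : sgraph.

Definition union_edge (x y : G + H) : bool :=
  match x, y with
  | inl a, inl b => edge a b
  | inr a, inr b => edge a b
  | _, _ => false
  end.

Lemma union_edge_sym : symmetric union_edge.
Proof. by case=> x [y|y] //; apply: edge_sym. Qed.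

Lemma union_edge_irrefl : irreflexive union_edge.
Proof. by case=> x; apply: edge_irrefl. Qed.

Definition disjoint_union := SGraph union_edge_sym union_edge_irrefl.
End DisjointUnion.

Section Copies.
Variables (r : nat) (H : sgraph).

Definition copies_edge : rel ('I_r * H) :=
  [rel x y | (x.1 == y.1) && edge x.2 y.2].

Lemma copies_edge_sym : symmetric copies_edge.
Proof. by move=> x y; rewrite /copies_edge /= eq_sym edge_sym. Qed.

Lemma copies_edge_irrefl : irreflexive copies_edge.
Proof. by move=> x; rewrite /copies_edge /= edge_irrefl andbF. Qed.

Definition copies := SGraph copies_edge_sym copies_edge_irrefl.
End Copies.

Definition P6_rP3 (r : nat) : sgraph :=
  disjoint_union (path_graph 6) (copies r (path_graph 3)).

Definition neighbors (G : sgraph) (v : G) : {set G} := [set u | edge v u].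

(* The graph with no vertices counts as connected. *)
Definition connected (G : sgraph) : Prop :=
  forall x y : G, connect (@edge G) x y.

Definition stable (G : sgraph) (A : {set G}) : Prop :=
  {in A &, forall x y, ~~ edge x y}.

(* (A1, A2) is a bipartition of the subgraph of G induced on X; as usual,
   a side may be empty. *)
Definition bipartition (G : sgraph) (X A1 A2 : {set G}) : Prop :=
  [/\ A1 :|: A2 = X, [disjoint A1 & A2], stable A1 & stable A2].

Section Reduce.
Variables (G : sgraph) (v : G) (A1 A2 : {set G}).

Definition reduce_rest : sgraph := induced (~: (v |: neighbors v)).

Definition has_neighbor_in (A : {set G}) (u : G) : bool :=
  [exists w in A, edge u w].

(* The new vertices a1 and a2 are [inr true] and [inr false]. *)
Definition reduce_side (i : bool) : {set G} := if i then A1 else A2.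

Definition reduce_edge (x y : reduce_rest + bool) : bool :=
  match x, y with
  | inl u, inl w => edge u w
  | inl u, inr i | inr i, inl u => has_neighbor_in (reduce_side i) (val u)
  | inr i, inr j => i != j
  end.

Lemma reduce_edge_sym : symmetric reduce_edge.
Proof. by case=> x [y|y] //; [apply: edge_sym | rewrite /= eq_sym]. Qed.

Lemma reduce_edge_irrefl : irreflexive reduce_edge.
Proof. by case=> x; [apply: edge_irrefl | rewrite /= eqxx]. Qed.

Definition reduce := SGraph reduce_edge_sym reduce_edge_irrefl.
End Reduce.

(* Main.v *)
(* Only one component of a copy of P_6 + rP_3 in G' can use the new vertices
   a_1, a_2, since they are adjacent. In that path replace a_i by some w in A_i
   adjacent to the preceding or following old vertex; when the two sides call for
   different, nonadjacent w and w', join them through v. As v has no neighbor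
   outside N(v), this yields an induced path of G at least as long, with no edges
   to the other components, and it can be truncated. *)
Require Import Defs.
From mathcomp Require Import all_boot zify.

Set Implicit Arguments.
Unset Strict Implicit.
Unset Printing Implicit Defensive.

(** * Induced copies as embeddings *)

Definition embedding (H G : sgraph) (f : H -> G) : Prop :=
  injective f /\ {mono f : x y / edge x y}.

(** The image of an embedding induces a copy of [H], by counting; conversely, the inverse of an
    isomorphism is composed with the inclusion. From here on, copies are handled as maps only. *)
Lemma freeP (H G : sgraph) :
  free H G <-> (forall f : H -> G, ~ embedding f).
Proof.
split=> [G_free f [f_inj f_mono] | no_emb A [f [[g fK gK] f_mono]]].
- pose A := [set f x | x in H].
  have fA x : f x \in A by apply: imset_f.
  pose F x : induced A := exist (fun z => z \in A) (f x) (fA x).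
  have F_inj : injective F by move=> x y /(congr1 val) /f_inj.
  have [|g FK gK] := inj_card_bij F_inj; first by rewrite card_sig card_imset.
  apply: (G_free A); exists g; split; first by exists F.
  by move=> x y; rewrite -{2}(gK x) -{2}(gK y) /= [RHS]f_mono.
- apply: (no_emb (val \o g)); split.
    by apply: inj_comp; [apply: val_inj | apply: can_inj gK].
  by move=> x y; rewrite -{2}(gK x) -{2}(gK y) f_mono.
Qed.

(** * Induced paths as vertex sequences, and their concatenation *)

Section InducedPath.
Variable G : sgraph.
Implicit Types (x y : G) (s t : seq G).

Fixpoint induced_path s : bool :=
  if s is x :: s' then
    [&& x \notin s', all (fun y => edge x y == (y == head x s')) s' & induced_path s']
  else true.

(** The condition on cross pairs that makes the concatenation of two induced paths induced. It is
    vacuous when either sequence is empty, so the defaults of [last] and [head] are never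
    reached. *)
Definition linked s t : Prop :=
  {in s & t, forall x y, x != y /\ edge x y = (x == last y s) && (y == head x t)}.

Lemma induced_path_cat s t :
  induced_path (s ++ t) <-> [/\ induced_path s, induced_path t & linked s t].
Proof.
elim: s => [|x s IHs] /=; first by split=> [->|[]].
split.
- case/and3P; rewrite mem_cat negb_or all_cat.
  case/andP=> xs xt /andP[es et] /IHs[ps pt lst].
  have ust : {in s & t, forall y z, y != z} by move=> y z ys /(lst _ _ ys) [].
  split=> //.
    apply/and3P; split=> //; apply/allP=> y ys.
    by have := allP es y ys; case: (s) ys.
  move=> y z; rewrite inE => /predU1P[->|ys] zt.
    split; first by apply: contraNneq xt => ->.
    have := allP et z zt => /eqP ->; case: (s) xs ust => [|u s'] /=.
      by rewrite eqxx.
    (* Both sides are false: [x] is not the last vertex, as it does not recur, and [z] differs from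
       the successor [u] of [x]. *)
    move=> xs ust; have /negPf-> : x != last u s'.
      by apply: contraNneq xs => ->; apply: mem_last.
    by rewrite eq_sym (negPf (ust _ _ (mem_head _ _) zt)).
  have [yz eyz] := lst _ _ ys zt; split=> //; rewrite eyz.
  by case: (s) ys.
- case=> /and3P[xs es ps] pt lst; rewrite mem_cat negb_or xs all_cat /=.
  have xt : x \notin t.
    by apply/negP=> xt; have [] := lst _ _ (mem_head _ _) xt; rewrite eqxx.
  rewrite xt -andbA /=; apply/and3P; split.
  + by apply/allP=> y ys; have := allP es y ys; case: (s) ys.
  + apply/allP=> z zt; have [_ ->] := lst _ _ (mem_head _ _) zt; apply/eqP.
    case: (s) xs lst => [|u s'] /=; first by rewrite eqxx.
    move=> xs lst; have /negPf-> : x != last u s'.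
      by apply: contraNneq xs => ->; apply: mem_last.
    have [|] := lst u z _ zt; first by rewrite !inE eqxx orbT.
    by rewrite eq_sym => /negPf->.
  + apply/IHs; split=> // y z ys zt.
    have [|yz ->] := lst y z _ zt; first by rewrite inE ys orbT.
    by split=> //; case: (s) ys.
Qed.

(** The bridge to [path_graph], whose adjacency is expressed on indices: it is used in both
    directions, to read a path off an embedding and to build one. *)
Lemma induced_pathP x0 s :
  induced_path s <-> uniq s /\ (forall i j, i < j < size s ->
                          edge (nth x0 s i) (nth x0 s j) = (i.+1 == j)).
Proof.
elim: s => [|x s IHs] /=; first by split=> // _; split=> // i j; rewrite ltn0 andbF.
split.
- case/and3P=> xs es /IHs[us ps]; split; first by rewrite xs.
  move=> [|i] [|j] //=; rewrite ltnS => js; last exact: ps.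
  have /eqP-> := allP es _ (mem_nth x0 js).
  have s0 : 0 < size s by lia.
  by case: (s) s0 us js => // y t _ us js /=; rewrite -[y]/(nth x0 (y :: t) 0)
    nth_uniq // eqSS eq_sym.
- case=> /andP[xs us] ps; rewrite xs /=; apply/andP; split.
    apply/allP=> y ys; apply/eqP; rewrite -(nth_index x0 ys).
    have js : index y s < size s by rewrite index_mem.
    have := ps 0 (index y s).+1 js => /= ->.
    have s0 : 0 < size s by lia.
    by case: (s) s0 us js => // z t _ us js /=; rewrite -[z]/(nth x0 (z :: t) 0)
      -[if _ then _ else _]/(index y (z :: t)) nth_uniq // eqSS eq_sym.
  by apply/IHs; split=> // i j ij; apply: (ps i.+1 j.+1).
Qed.

Definition anticomplete s t : Prop :=
  {in s & t, forall x y, x != y /\ edge x y = false}.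

(** A nonempty [m] keeps the end of [s] and the start of [t] from becoming consecutive, so [s] and
    [t] have to be anticomplete. *)
Lemma induced_path_glue s m t :
    m != [::] -> induced_path s -> induced_path m -> induced_path t ->
  linked s m -> linked m t -> anticomplete s t -> induced_path (s ++ m ++ t).
Proof.
move=> m0 ps pm pt lsm lmt ast; apply/induced_path_cat; split=> //.
  exact/induced_path_cat.
case: m m0 pm lsm lmt => // u m _ pm lsm lmt x y xs.
rewrite mem_cat => /orP[ym|yt].
  by have [xy ->] := lsm _ _ xs ym.
have [xy ->] := ast _ _ xs yt; split=> //=.
suff /negPf-> : y != u by rewrite andbF.
by have [] := lmt _ _ (mem_head _ _) yt; rewrite eq_sym.
Qed.

End InducedPath.

(** * Joining two paths through [v] and its neighbors *)

Section Splice.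
Variables (G : sgraph) (v : G).
Implicit Types (w x y : G) (s t : seq G) (B C : {set G}).

Definition outside s : Prop := {in s, forall x, x != v /\ ~~ edge v x}.

Lemma outside_neq s x w : outside s -> x \in s -> edge v w -> x != w.
Proof. by move=> os /os[_ vx] vw; apply: contraNneq vx => ->. Qed.

Lemma linked_right1 s w :
    outside s -> edge v w -> edge (last v s) w ->
    {in s, forall x, edge x w -> x = last x s} ->
  linked s [:: w].
Proof.
move=> os vw ew hs x y xs; rewrite inE => /eqP->; split.
  exact: outside_neq os xs vw.
rewrite /= eqxx andbT; case: s os ew hs xs => //= u s _ ew hs xs.
by apply/idP/eqP => [/(hs _ xs) | ->].
Qed.

Lemma linked_left1 s w :
    outside s -> edge v w -> edge w (head v s) ->
    {in s, forall x, edge x w -> x = head x s} ->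
  linked [:: w] s.
Proof.
move=> os vw ew hs x y; rewrite inE => /eqP-> ys; split.
  by rewrite eq_sym; apply: outside_neq os ys vw.
rewrite /= eqxx /=; case: s os ew hs ys => //= u s _ ew hs ys.
by apply/idP/eqP => [|->//]; rewrite edge_sym => /(hs _ ys).
Qed.

Lemma linked_right_hub s w :
  outside s -> edge v w -> linked (s ++ [:: w]) [:: v].
Proof.
move=> os vw x y; rewrite mem_cat !inE => xs /eqP->; rewrite last_cat eqxx andbT.
have wv : w != v by apply: contraTneq vw => ->; rewrite edge_irrefl.
case/orP: xs => [xs | /eqP->]; last by rewrite /= eqxx edge_sym vw.
by have [-> /negPf] := os _ xs; rewrite edge_sym (negPf (outside_neq os xs vw)).
Qed.

Lemma linked_left_hub s w :
  outside s -> edge v w -> linked [:: v] (w :: s).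
Proof.
move=> os vw x y; rewrite !inE => /eqP-> ys; rewrite /= eqxx andTb.
have wv : v != w by apply: contraTneq vw => ->; rewrite edge_irrefl.
case/predU1P: ys => [-> | ys]; first by rewrite eqxx vw.
by have [+ /negPf] := os _ ys; rewrite eq_sym (negPf (outside_neq os ys vw)).
Qed.

(* [b] tells whether the gap between [s] and [t] stands for the edge of the two
   new vertices ([b = true]) or for only one of them. *)
Lemma splice (b : bool) B C s t :
    B \subset neighbors v -> C \subset neighbors v ->
    induced_path s -> induced_path t -> outside s -> outside t -> anticomplete s t ->
    {in s & B :|: C, forall x w, edge x w -> x = last x s} ->
    {in t & B :|: C, forall y w, edge y w -> y = head y t} ->
    (s != [::] -> exists2 w, w \in B & edge (last v s) w) ->
    (t != [::] -> exists2 w, w \in C & edge w (head v t)) ->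
    (if b then [/\ [disjoint B & C], {in s & C, forall x w, ~~ edge x w}
                 & {in t & B, forall y w, ~~ edge y w}]
     else B = C /\ stable B) ->
    b <= size (s ++ t) ->
  exists m, [/\ induced_path (s ++ m ++ t), b < size m &
               {in m, forall w, w = v \/ w \in B :|: C}].
Proof.
move=> sBN sCN ps pt os ot ast hs ht exs ext hb szb.
have Bv w : w \in B -> edge v w by move/(subsetP sBN); rewrite inE.
have Cv w : w \in C -> edge v w by move/(subsetP sCN); rewrite inE.
have hsB w : w \in B -> {in s, forall x, edge x w -> x = last x s}.
  by move=> wB x xs; apply: hs xs _; rewrite inE wB.
have hsC w : w \in C -> {in s, forall x, edge x w -> x = last x s}.
  by move=> wC x xs; apply: hs xs _; rewrite inE wC orbT.
have htB w : w \in B -> {in t, forall x, edge x w -> x = head x t}.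
  by move=> wB x xt; apply: ht xt _; rewrite inE wB.
have htC w : w \in C -> {in t, forall x, edge x w -> x = head x t}.
  by move=> wC x xt; apply: ht xt _; rewrite inE wC orbT.
(* Each side, once extended by a neighbor of [v], can be continued by [v], which has no neighbor in
   the side itself. *)
have arm_l w : s != [::] -> w \in B -> edge (last v s) w ->
    induced_path (s ++ [:: w]) /\ linked (s ++ [:: w]) [:: v].
  move=> s0 wB ew; split; last exact: linked_right_hub (Bv w wB).
  by apply/induced_path_cat; split=> //; apply: linked_right1 (Bv w wB) _ (hsB w wB).
have arm_r w : t != [::] -> w \in C -> edge w (head v t) ->
    induced_path (w :: t) /\ linked [:: v] (w :: t).
  move=> t0 wC ew; split; last exact: linked_left_hub (Cv w wC).
  by apply/(@induced_path_cat _ [:: w]); split=> //;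
    apply: linked_left1 (Cv w wC) _ (htC w wC).
have [s0|s0] := eqVneq s [::]; have [t0|t0] := eqVneq t [::].
(* Here the size hypothesis forces [b = false], so one vertex is long enough. *)
- subst s t; exists [:: v]; split=> //; last by move=> w; rewrite inE => /eqP; left.
(* With one side empty, [v] serves as a new end of the path; the two added vertices suffice for
   either value of [b]. *)
- have [w wC ew] := ext t0; have [pw lw] := arm_r w t0 wC ew.
  exists [:: v; w]; split; [rewrite s0 /= | by case: (b) |].
    exact/(@induced_path_cat _ [:: v]).
  by move=> u; rewrite !inE => /orP[/eqP | /eqP->]; [left | right; rewrite wC orbT].
- have [w wB ew] := exs s0; have [pw lw] := arm_l w s0 wB ew.
  exists [:: w; v]; split; [rewrite t0 | by case: (b) |].
    by rewrite cats0 -[s ++ _]/(s ++ [:: w] ++ [:: v]) catA; apply/induced_path_cat.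
  by move=> u; rewrite !inE => /orP[/eqP-> | /eqP]; [right; rewrite wB | left].
have [w wB ew] := exs s0; have [w' wC ew'] := ext t0.
have [pw lw] := arm_l w s0 wB ew; have [pw' lw'] := arm_r w' t0 wC ew'.
have lsw := linked_right1 os (Bv w wB) ew (hsB w wB).
have lwt := linked_left1 ot (Cv w' wC) ew' (htC w' wC).
(* The detour through [v] is induced as soon as [w] and [w'] are distinct and nonadjacent and
   neither reaches the other side's end: inner vertices of [s] and [t] have no neighbor in [B] or
   [C]. *)
have via_v : w != w' -> ~~ edge w w' -> ~~ edge w (head v t) ->
    ~~ edge (last v s) w' ->
    exists m, [/\ induced_path (s ++ m ++ t), b < size m &
               {in m, forall w, w = v \/ w \in B :|: C}].
  move=> ww' nww' nwt nsw'; exists [:: w; v; w']; split; last 1 first.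
  - move=> u; rewrite !inE => /or3P[/eqP->|/eqP->|/eqP->]; [right|by left|right].
      by rewrite wB.
    by rewrite wC orbT.
  - rewrite -[s ++ _]/(s ++ [:: w] ++ [:: v] ++ w' :: t) catA.
    apply: induced_path_glue => // x y; rewrite mem_cat !inE => xs yt.
    case/orP: xs yt => [xs | /eqP->] /predU1P[-> | yt].
    + split; first exact: outside_neq os xs (Cv w' wC).
      apply: contraNF nsw' => exw'; have := hsC w' wC x xs exw'.
      by case: (s) xs => //= u s' _ <-.
    + exact: ast.
    + by rewrite ww' (negPf nww').
    + split; first by rewrite eq_sym; apply: outside_neq ot yt (Bv w wB).
      apply: contraNF nwt; rewrite edge_sym => eyw.
      have := htB w wB y yt eyw.
      by case: (t) yt => //= u t' _ <-; rewrite edge_sym.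
  - by case: (b).
have sl : last v s \in s by case: (s) s0 => //= u s' _; apply: mem_last.
have th : head v t \in t by case: (t) t0 => //= u t' _; apply: mem_head.
case: b hb szb via_v => [[dBC nsC ntB] _ | [eBC stB] _] via_v.
(* The two neighbors lie in disjoint sets and neither sees the far side, so they are either adjacent
   and used directly, or joined through [v]. *)
- have ww' : w != w' by apply: contraTneq wC => <-; rewrite (disjointFr dBC wB).
  have nwt : ~~ edge w (head v t) by rewrite edge_sym; apply: ntB.
  have nsw' : ~~ edge (last v s) w' by apply: nsC.
  case: (boolP (edge w w')) => [eww' | nww']; last exact: via_v.
  exists [:: w; w']; split=> //; last first.
    by move=> u; rewrite !inE => /orP[/eqP->|/eqP->]; right; rewrite ?wB ?wC ?orbT.
  apply: induced_path_glue => //.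
  + by rewrite /= !inE ww' eqxx eww'.
  + move=> x y xs; rewrite !inE => /predU1P[->|/eqP->].
      by apply: lsw => //; rewrite inE.
    split; first exact: outside_neq os xs (Cv w' wC).
    by rewrite (negPf (nsC x w' xs wC)) /= (eq_sym w') (negPf ww') andbF.
  + move=> x y; rewrite !inE => /predU1P[->|/eqP->] yt; last first.
      by have := lwt _ _ (mem_head _ _) yt; rewrite /= eqxx.
    split; first by rewrite eq_sym; apply: outside_neq ot yt (Bv w wB).
    by rewrite edge_sym (negPf (ntB y w yt wB)) /= (negPf ww').
have bridge u : u \in B -> edge (last v s) u -> edge u (head v t) ->
    exists m, [/\ induced_path (s ++ m ++ t), false < size m &
               {in m, forall w, w = v \/ w \in B :|: C}].
  move=> uB esu eut; exists [:: u]; split=> //; last first.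
    by move=> x; rewrite inE => /eqP->; right; rewrite inE uB.
  apply: induced_path_glue => //.
    exact: linked_right1 (Bv u uB) esu (hsB u uB).
  exact: linked_left1 (Bv u uB) eut (htB u uB).
(* If [w] or [w'] reaches both sides, it suffices alone. Otherwise [w] misses [head v t], hence
   differs from [w'], and stability of [B] makes the two nonadjacent, as the detour requires. *)
case: (boolP (edge w (head v t))) => [ewt | nwt]; first exact: (bridge w).
case: (boolP (edge (last v s) w')) => [esw' | nsw'].
  by apply: (bridge w'); rewrite // eBC.
apply: via_v => //; last by apply: stB; rewrite // eBC.
by apply: contraNneq nwt => ->.
Qed.

End Splice.

(** * From paths and embeddings in the reduced graph to the original graph *)

Section Reroute.
Variables (G : sgraph) (v : G) (A1 A2 : {set G}).
Hypothesis Nv_bipartition : bipartition (neighbors v) A1 A2.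
Local Notation G' := (reduce v A1 A2).
Local Notation rest := (reduce_rest v).
Local Notation side := (reduce_side A1 A2).
Local Notation old := (@inl rest bool).
Local Notation new := (@inr rest bool).

Lemma side_sub i : side i \subset neighbors v.
Proof.
by case: Nv_bipartition => <- _ _ _; case: i; [apply: subsetUl | apply: subsetUr].
Qed.

Lemma side_stable i : stable (side i).
Proof. by case: Nv_bipartition => _ _ st1 st2; case: i. Qed.

Lemma side_disjoint i : [disjoint side i & side (~~ i)].
Proof. by case: Nv_bipartition => _ d _ _; case: i => //=; rewrite disjoint_sym. Qed.

Lemma rest_outside (s : seq rest) : outside v (map val s).
Proof.
move=> _ /mapP[x _ ->]; have := valP x; rewrite !inE negb_or.
by case/andP.
Qed.

Lemma edge_new (x : rest) i w :
  w \in side i -> edge (val x) w -> edge (old x : G') (new i).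
Proof. by move=> wi xw; apply/existsP; exists w; rewrite wi. Qed.

Lemma edge_newP (x : rest) i :
  edge (old x : G') (new i) -> exists2 w, w \in side i & edge (val x) w.
Proof. by case/existsP=> w /andP[]; exists w. Qed.

Lemma induced_path_old (s : seq rest) :
  @induced_path G' (map old s) -> induced_path (map val s).
Proof.
have old_inj : injective old by move=> x y [].
elim: s => //= x s IHs /and3P[xs es /IHs->]; rewrite andbT.
rewrite (mem_map old_inj) in xs; rewrite (mem_map val_inj) xs /=.
apply/allP=> _ /mapP[y ys ->]; have := allP es _ (map_f _ ys).
by case: (s).
Qed.

Lemma split_new (s : seq G') :
  (exists t, s = map old t) \/ (exists t i u, s = map old t ++ new i :: u).
Proof.
elim: s => [|[x|i] s [[t ->]|[t [j [u ->]]]]].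
- by left; exists [::].
- by left; exists (x :: t).
- by right; exists (x :: t), j, u.
- by right; exists [::], i, (map old t).
- by right; exists [::], i, (map old t ++ new j :: u).
Qed.

(** The new vertices are adjacent, so if an induced path contains both, they are consecutive on it.
    The factor [nseq b] holds the second one exactly when [b] is true. *)
Lemma new_segment (s : seq G') i :
    induced_path s -> (new i : G') \in s ->
  exists t u j (b : bool),
    s = map old t ++ (new j :: nseq b (new (~~ j) : G')) ++ map old u.
Proof.
move=> ps si; have [[t es]|[t [j [s1 es]]]] := split_new s.
  by move: si; rewrite es => /mapP[].
exists t; move: ps; rewrite es => /induced_path_cat[_ /= /and3P[js1 ej ps1] _].
have [[u es1]|[u [k [s2 es1]]]] := split_new s1.
  by exists u, j, false; rewrite es1.
have kj : k = ~~ j.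
  move: js1; rewrite es1 mem_cat !inE !negb_or => /and3P[_ + _].
  by case: (j) (k) => [] [].
(* The successor of [new j] is its only later neighbor on the path, so [new k] must come immediately
   after it. *)
have u0 : u = [::].
  have ks1 : (new k : G') \in s1 by rewrite es1 mem_cat mem_head orbT.
  have := allP ej _ ks1; rewrite es1 kj /=.
  by case: (u) => //= x u'; case: (j).
have [[u' es2]|[u' [l [s3 es2]]]] := split_new s2.
  by exists u', j, true; rewrite es1 u0 es2 kj.
(* A third new vertex would repeat one of the first two. *)
have ls2 : (new l : G') \in s2 by rewrite es2 mem_cat mem_head orbT.
move: js1 ps1; rewrite es1 u0 /= inE negb_or => /andP[_ js2] /andP[ks2 _].
by case: (eqVneq l j) ls2 => [->|]; rewrite ?(negPf js2) // kj in ks2 *;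
  case: (l) (j) js2 ks2 => [] [] // _ /negPf->.
Qed.

(** [splice] is applied to the old parts before and after the new segment. The origin of each vertex
    of [s1] is recorded because it controls edges to old vertices off [s]: these miss [v], and one
    with a neighbor in side [j] is adjacent to [new j] in the reduced graph. *)
Lemma reroute_induced_path (s : seq G') i :
    induced_path s -> 2 < size s -> (new i : G') \in s ->
  exists s1 : seq G, [/\ induced_path s1, size s <= size s1 &
    {in s1, forall y, [\/ exists2 x, (old x : G') \in s & y = val x, y = v
                        | exists2 j, (new j : G') \in s & y \in side j]}].
Proof.
move=> ps szs si; have [t [u [j [b es]]]] := new_segment ps si.
(* [k] indexes the last new vertex of the segment, as [j] indexes the first. *)
pose k := if b then ~~ j else j.
pose m := new j :: nseq b (new (~~ j) : G').
have kb : if b then k = ~~ j else k = j by rewrite /k; case: (b).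
have lastm : last (new j : G') m = new k by rewrite /m /k; case: (b).
have memm l : (new l : G') \in m = (l == j) || (l == k).
  by rewrite /m /k; case: (b) (l) (j) => [] [] [].
move: ps; rewrite es -/m => /induced_path_cat[pt pmu ltmu].
have /induced_path_cat[pm pu lmu] := pmu.
have tu : anticomplete (map val t) (map val u).
  move=> _ _ /mapP[x xt ->] /mapP[y yu ->].
  have [|xy exy] := ltmu (old x) (old y) (map_f _ xt) _.
    by rewrite mem_cat map_f ?orbT.
  split; first by rewrite (inj_eq val_inj); apply: contraNneq xy => ->.
  by rewrite -[LHS]/(@edge G' (old x) (old y)) exy andbF.
(* An edge of [G] from [val x] to a side gives an edge to the corresponding new vertex, and since
   [s] is induced this can only be the consecutive pair at the junction. *)
have tnew x l : x \in t -> (new l : G') \in m -> edge (old x : G') (new l) ->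
    l = j /\ old x = last (new l) (map old t) :> G'.
  move=> xt lm; have [|_ ->] := ltmu (old x) (new l) (map_f _ xt) _.
    by rewrite mem_cat lm.
  by case/andP=> /eqP xl /eqP[].
have unew x l : x \in u -> (new l : G') \in m -> edge (old x : G') (new l) ->
    l = k /\ old x = head (new l) (map old u) :> G'.
  move=> xu lm; rewrite edge_sym; have [_ ->] := lmu _ (old x) lm (map_f _ xu).
  rewrite (_ : last _ _ = new k); last by rewrite -lastm.
  by case/andP=> /eqP[] -> /eqP.
have last_t x l : old x = last (new l) (map old t) :> G' ->
    val x = last (val x) (map val t).
  by case: (t) => //= z t'; rewrite (last_map old) last_map => -[->].
have head_u x l : old x = head (new l) (map old u) :> G' ->
    val x = head (val x) (map val u).
  by case: (u) => //= z u' [->].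
have newj : (new j : G') \in m by rewrite memm eqxx.
have newk : (new k : G') \in m by rewrite memm eqxx orbT.
have sideP w : w \in side j :|: side k -> exists2 l, (new l : G') \in m & w \in side l.
  by rewrite inE => /orP[wj | wk]; [exists j | exists k].
have [| | | | | |m1 [pm1 szm1 hm1]] :=
  splice (b := b) (side_sub j) (side_sub k) (induced_path_old pt) (induced_path_old pu)
    (@rest_outside t) (@rest_outside u) tu.
- move=> _ w /mapP[x xt ->] /sideP[l lm wl] /(edge_new wl) /(tnew _ _ xt lm)[_].
  exact: last_t.
- move=> _ w /mapP[x xu ->] /sideP[l lm wl] /(edge_new wl) /(unew _ _ xu lm)[_].
  exact: head_u.
- move=> t0; have [z [zt [zl zv]]] : exists z, z \in t /\
      old z = last (new j) (map old t) :> G' /\ last v (map val t) = val z.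
    case: (t) t0 => //= y t' _; exists (last y t').
    by rewrite mem_last (last_map old) last_map.
  rewrite zv; apply: edge_newP.
  have [|_ ->] := ltmu (old z) (new j) (map_f _ zt) _.
    by rewrite mem_cat newj.
  by rewrite /= -zl !eqxx.
- move=> u0; have [z [zu [zl zv]]] : exists z, z \in u /\
      old z = head (new k) (map old u) :> G' /\ head v (map val u) = val z.
    by case: (u) u0 => //= y u' _; exists y; rewrite mem_head.
  rewrite zv; have [|w wk zw] := @edge_newP z k.
    rewrite edge_sym; have [_ ->] := lmu _ (old z) newk (map_f _ zu).
    by rewrite -zl eqxx andbT -lastm; case: (m) newk.
  by exists w; rewrite // edge_sym.
- case: (b) kb => kb; last by rewrite kb; split=> //; apply: side_stable.
  split; first by rewrite kb; apply: side_disjoint.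
    move=> _ w /mapP[x xt ->] wk; apply/negP=> /(edge_new wk) /(tnew _ _ xt newk)[].
    by rewrite kb; case: (j).
  move=> _ w /mapP[x xu ->] wj; apply/negP=> /(edge_new wj) /(unew _ _ xu newj)[].
  by rewrite kb; case: (j).
(* Having more than two vertices, the path keeps an old one even if it uses both new ones. *)
- by move: szs; rewrite es !size_cat /= !size_map size_nseq; clear; case: b; lia.
exists (map val t ++ m1 ++ map val u); split=> //.
  by move: szm1; rewrite !size_cat /= !size_map size_nseq; clear; lia.
move=> y; rewrite !mem_cat => /or3P[/mapP[x xt ->] | /hm1[-> | yjk] | /mapP[x xu ->]].
- by constructor 1; exists x; rewrite // mem_cat (map_f old xt).
- by constructor 2.
- have [l lm yl] := sideP _ yjk.
  by constructor 3; exists l; rewrite // !mem_cat lm orbT.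
- by constructor 1; exists x; rewrite // !mem_cat (map_f old xu) !orbT.
Qed.

(** Only the values of [f] on the path [p] are changed. A general [H] and length [n] cover the long
    component and the short ones alike. *)
Lemma reroute_embedding (H : sgraph) n (p : path_graph n -> H) (f : H -> G') k i :
    2 < n -> embedding p -> embedding f ->
    (forall h, h \notin codom p -> forall l, ~~ edge h (p l)) ->
    f (p k) = new i ->
  exists g : H -> G, embedding g.
Proof.
move=> n2 [p_inj p_mono] [f_inj f_mono] p_closed fk.
case: n n2 p p_inj p_mono p_closed k fk => // n n2 p p_inj p_mono p_closed k fk.
pose s : seq G' := [seq f (p l) | l <- enum 'I_n.+1].
have szs : size s = n.+1 by rewrite size_map size_enum_ord.
have nths x0 l : l < n.+1 -> nth x0 s l = f (p (inord l)).
  move=> ln; rewrite (nth_map ord0) ?size_enum_ord //.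
  by congr (f (p _)); apply: val_inj; rewrite /= nth_enum_ord ?inordK.
have path_edgeE (a b : 'I_n.+1) :
    a < b -> @edge (path_graph n.+1) a b = (a.+1 == b :> nat).
  move=> ab; rewrite /= /path_edge /= (_ : (b.+1 == a :> nat) = false) ?orbF //.
  by apply: contraTF ab => /eqP <-; rewrite -leqNgt leqnSn.
have us : uniq s by rewrite map_inj_uniq ?enum_uniq //; apply: inj_comp.
have ps : induced_path s.
  apply/(induced_pathP (f (p k))); split=> // a b; rewrite szs => /andP[ab bn].
  have an := ltn_trans ab bn.
  by rewrite !nths // f_mono p_mono path_edgeE !inordK.
have sp h : f h \in s -> h \in codom p.
  by case/mapP=> l _ /f_inj ->; apply: codom_f.
have si : (new i : G') \in s.
  by apply/mapP; exists k; rewrite ?mem_enum // fk.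
have [|s1 [ps1 szs1 hs1]] := reroute_induced_path ps _ si; first by rewrite szs.
(* The other new vertex is adjacent to [new i], so it cannot be the image of a vertex off the
   path. *)
have h_old h : h \notin codom p -> exists x, f h = old x.
  case E: (f h) => [x|j] hp; first by exists x.
  have := p_closed h hp k; rewrite -f_mono E fk /=.
  case: eqP => // ji _; case/negP: hp; apply: sp; rewrite E ji //.
(* The rerouted path may be longer; its first [n.+1] vertices are kept. *)
pose q (l : 'I_n.+1) := nth v s1 l.
have szq (l : 'I_n.+1) : l < size s1 by apply: leq_trans (ltn_ord l) _; rewrite -szs.
have [us1 es1] := (induced_pathP v s1).1 ps1.
have qP : {mono q : a b / @edge (path_graph n.+1) a b >-> edge a b}.
  suff lt_mono (a b : 'I_n.+1) : a < b -> edge (q a) (q b) = @edge (path_graph n.+1) a b.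
    move=> a b; case: (ltngtP a b) => [||/val_inj ->]; first exact: lt_mono.
      by move=> ba; rewrite edge_sym [RHS]edge_sym; apply: lt_mono.
    by rewrite !edge_irrefl.
  by move=> ab; rewrite es1 ?ab ?szq // path_edgeE.
have q_inj : injective q.
  by move=> a b /eqP; rewrite nth_uniq // => /eqP /val_inj.
(* The vertex [val x] avoids [v] and its neighbors. If it had a neighbor in side [j], then [old x]
   would be adjacent to [new j], which lies on [s], against [p_closed]. *)
have q_far (l : 'I_n.+1) h x : h \notin codom p -> f h = old x ->
    q l != val x /\ edge (q l) (val x) = false.
  move=> hp fh; have := rest_outside (map_f val (mem_head x [::])) => -[xv vx].
  have [[y ys ->]| -> |[j js yj]] := hs1 (q l) (mem_nth v (szq l)).
  - have /mapP[l' _ yl] := ys; split.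
      by rewrite (inj_eq val_inj); apply: contraNneq hp => yx; apply: sp; rewrite fh -yx.
    by have := p_closed h hp l'; rewrite -f_mono fh -yl edge_sym => /negPf.
  - by rewrite eq_sym xv (negPf vx).
  - have ej := subsetP (side_sub j) _ yj; rewrite inE in ej; split.
      by apply: contraNneq vx => <-.
    apply/negP; rewrite edge_sym => /(edge_new yj).
    have /mapP[l' _ ->] := js; rewrite -fh f_mono.
    exact/negP/p_closed.
(* [pick] inverts [p]. The final [v] is a mere default, since by [h_old] vertices off the path have
   old images. *)
pose g h := if [pick l | p l == h] is Some l then q l
            else if f h is inl x then val (x : rest) else v.
have g_in l : g (p l) = q l.
  rewrite /g; case: pickP => [l' /eqP /p_inj -> //|/(_ l)].
  by rewrite eqxx.
have g_out h x : h \notin codom p -> f h = old x -> g h = val x.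
  move=> hp fh; rewrite /g fh; case: pickP => // l /eqP hl.
  by case/negP: hp; rewrite -hl codom_f.
exists g; split.
- move=> h1 h2; case: (boolP (h1 \in codom p)) => [/codomP[l1 ->]|hp1];
    case: (boolP (h2 \in codom p)) => [/codomP[l2 ->]|hp2].
  + by rewrite !g_in => /q_inj->.
  + have [x fx] := h_old _ hp2; rewrite g_in (g_out _ _ hp2 fx) => /eqP.
    by have [/negPf->] := q_far l1 _ _ hp2 fx.
  + have [x fx] := h_old _ hp1; rewrite g_in (g_out _ _ hp1 fx) => /esym /eqP.
    by have [/negPf->] := q_far l2 _ _ hp1 fx.
  + have [x fx] := h_old _ hp1; have [y fy] := h_old _ hp2.
    rewrite (g_out _ _ hp1 fx) (g_out _ _ hp2 fy) => /val_inj xy.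
    by apply: f_inj; rewrite fx fy xy.
- move=> h1 h2; case: (boolP (h1 \in codom p)) => [/codomP[l1 ->]|hp1];
    case: (boolP (h2 \in codom p)) => [/codomP[l2 ->]|hp2].
  + by rewrite !g_in qP p_mono.
  + have [x fx] := h_old _ hp2; rewrite g_in (g_out _ _ hp2 fx).
    have [_ ->] := q_far l1 _ _ hp2 fx.
    by rewrite edge_sym (negPf (p_closed _ hp2 l1)).
  + have [x fx] := h_old _ hp1; rewrite g_in (g_out _ _ hp1 fx) edge_sym.
    have [_ ->] := q_far l2 _ _ hp1 fx.
    by rewrite (negPf (p_closed _ hp1 l2)).
  + have [x fx] := h_old _ hp1; have [y fy] := h_old _ hp2.
    by rewrite (g_out _ _ hp1 fx) (g_out _ _ hp2 fy) -f_mono fx fy.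
Qed.

End Reroute.

(** * Rerouting the component that meets a new vertex *)

Theorem theorem5p1 (r : nat) (G : sgraph) (v : G) (A1 A2 : {set G})
  (G_free : free (P6_rP3 r) G)
  (Nv_connected : connected (induced (neighbors v)))
  (Nv_bipartition : bipartition (neighbors v) A1 A2) :
  free (P6_rP3 r) (reduce v A1 A2).
Proof.
apply/freeP=> f f_emb; have /freeP no_emb := G_free.
suff [g /no_emb //] : exists g : P6_rP3 r -> G, embedding g.
have [f_inj f_mono] := f_emb.
case: (pickP (fun h => ~~ (if f h is inl _ then true else false))) => [h | f_old].
  case fh: (f h) => [//|i] _; case: h fh => [k|[c k]] fh.
  (* The new vertex lies on the six-vertex path; the other case below treats copy [c] of the
     three-vertex path. *)
  - apply: (@reroute_embedding _ _ _ _ Nv_bipartition (P6_rP3 r) 6 inl f k i) => //.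
      by split=> // x y [].
    by move=> [l|//] /codomP[]; exists l.
  - apply: (@reroute_embedding _ _ _ _ Nv_bipartition (P6_rP3 r) 3
      (fun l => inr (c, l)) f k i) => //.
      by split=> [x y []|x y] //=; rewrite /copies_edge /= eqxx.
    move=> [//|[c' l]] hp l'; rewrite /= /copies_edge /=; case: eqP => // cc'.
    by case/codomP: hp; exists l; rewrite cc'.
(* No new vertex is used, so the copy already lies in [G]. *)
exists (fun h => if f h is inl x then val x else v); split.
- move=> h1 h2; have:= f_old h1; have := f_old h2.
  case E1: (f h1) => [x|] //; case E2: (f h2) => [y|] // _ _ /val_inj xy.
  by apply: f_inj; rewrite E1 E2 xy.
- move=> h1 h2; have:= f_old h1; have := f_old h2; rewrite -f_mono.
  by case: (f h1) => [x|] //; case: (f h2).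
Qed.
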